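(* Assume $y_1(t)\to0$ as $t\to\infty$. Then the following are equivalent: (S) $\int_0^t\cos(\omega s)A(s)y_1(s)\,ds=o(A(t))$ and $\int_0^t\sin(\omega s)A(s)y_1(s)\,ds=o(A(t))$ as $t\to\infty$; (T) $\int_0^t\cos(\omega s)A(s)f(s)\,ds=o(A(t))$ and $\int_0^t\sin(\omega s)A(s)f(s)\,ds=o(A(t))$ as $t\to\infty$.
   Context: Standing assumptions: $\omega>0$ is a constant; $p\in C^1([0,\infty))$ with $p(t)>0$ and $p'(t)<0$ for all $t\ge0$, $\int_0^\infty p(t)\,dt=\infty$ and $\int_0^\infty p(t)^2\,dt<\infty$; $f\in L^1_{\mathrm{loc}}([0,\infty))$. Notation: $A(t)=\exp(\frac12\int_0^tp(s)\,ds)$ (so $A(t)\to\infty$); $y_1(t)=\int_0^te^{-\omega^2(t-s)}f(s)\,ds$, the solution of $y_1'=-\omega^2y_1+f$, $y_1(0)=0$. *)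

(* Defs.v *)
From HB Require Import structures.
From mathcomp Require Import all_boot all_order all_algebra.
From mathcomp Require Import all_classical all_reals all_analysis.
Set Implicit Arguments. Unset Strict Implicit. Unset Printing Implicit Defensive.
Import Order.TTheory GRing.Theory Num.Theory.
Import numFieldNormedType.Exports.
Local Open Scope classical_set_scope.
Local Open Scope ring_scope.

Section Defs.
Variable R : realType.
Notation leb := (@lebesgue_measure R).

Definition C1_on_nonneg (p dp : R -> R) : Prop :=
  (forall t : R, 0 < t -> is_derive t 1 p (dp t)) /\
  ((fun h : R => h^-1 * (p h - p 0)) @ 0^'+ --> dp 0) /\
  {within `[0, +oo[, continuous dp}.

Definition L1loc_nonneg (f : R -> R) : Prop :=
  forall T : R, 0 <= T -> leb.-integrable `[0, T] (EFin \o f).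

Definition Afun (p : R -> R) (t : R) : R :=
  expR (2^-1 * \int[leb]_(s in `[0, t]) p s).

Definition y1fun (w : R) (f : R -> R) (t : R) : R :=
  \int[leb]_(s in `[0, t]) (expR (- (w ^+ 2) * (t - s)) * f s).

(* g = o(h) as t -> +oo; this is literally MathComp-Analysis' (local)
   littleo_def for the filter +oo (the =o_ notation needs a filter_on
   instance that pinfty_nbhs lacks). *)
Definition littleo_pinfty (g h : R -> R) : Prop :=
  forall eps : R, 0 < eps -> \forall t \near +oo, `|g t| <= eps * `|h t|.

End Defs.

(* Main.v *)
Require Import Defs.
From HB Require Import structures.
From mathcomp Require Import all_boot all_order all_algebra.
From mathcomp Require Import all_classical all_reals all_analysis.
From mathcomp Require Import measurable_realfun.
From mathcomp Require Import ring lra.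
Import Order.TTheory GRing.Theory Num.Theory.
Import numFieldNormedType.Exports.
Local Open Scope classical_set_scope.
Local Open Scope ring_scope.

(* Write X, Y for the cosine and sine integrals of A y1, and U, V for those of
   A f. Substituting f = y1' + w^2 y1 and integrating by parts gives
     U = w^2 X + w Y + cos(w t) A(t) y1(t) - int_0^t cos(w s) A'(s) y1(s) ds
     V = w^2 Y - w X + sin(w t) A(t) y1(t) - int_0^t sin(w s) A'(s) y1(s) ds.
   As y1 -> 0, A' = p A / 2 >= 0 and A -> oo, the last two terms of each line
   are o(A), so (U, V) and (X, Y) are related, modulo o(A), by an invertible
   linear map. *)

(** * Fubini on a triangle, integration by parts, divergent primitives *)

Section Preliminaries.
Context {R : realType}.
Notation mu := (@lebesgue_measure R).

(** Both sides are iterated integrals of [h s * k r] over the triangle [0 <= r <= s <= t], so Fubini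
    applies. *)
Lemma Rintegral_swap_triangle (h k : R -> R) (t : R) :
  mu.-integrable `[0, t] (EFin \o h) ->
  mu.-integrable `[0, t] (EFin \o k) ->
  \int[mu]_(s in `[0, t])
    (h s * \int[mu]_(r in `[0, s]) k r) =
  \int[mu]_(r in `[0, t])
    (k r * \int[mu]_(s in `[r, t]) h s).
Proof.
move=> ih ik.
have ih0 : mu.-integrable setT (EFin \o (h \_ `[0, t])).
  by rewrite -restrict_EFin -integrable_mkcond.
have ik0 : mu.-integrable setT (EFin \o (k \_ `[0, t])).
  by rewrite -restrict_EFin -integrable_mkcond.
set h0 := h \_ `[0, t] in ih0; set k0 := k \_ `[0, t] in ik0.
have /integrableP[/measurable_EFinP mh0 _] := ih0.
have /integrableP[/measurable_EFinP mk0 _] := ik0.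
(* Extension by zero outside the triangle, so that Fubini can be used on the whole plane. *)
pose Phi (z : measurableTypeR R * measurableTypeR R) : R :=
  if z.2 <= z.1 then h0 z.1 * k0 z.2 else 0.
have mPhi : measurable_fun setT Phi.
  apply: measurable_fun_ifT => //=.
  - apply: measurable_fun_ler.
    + exact: measurable_snd.
    + exact: measurable_fst.
  - apply: measurable_funM.
    + exact: (measurableT_comp mh0 measurable_fst).
    + exact: (measurableT_comp mk0 measurable_snd).
have iPhi : (mu \x mu)%E.-integrable setT (EFin \o Phi).
  apply/(integrable12ltyP mu mu); first exact/measurable_EFinP.
  (* Dropping the constraint [r <= s] bounds the integral of [Phi] in absolute value by the product
     of the integrals of [|h0|] and [|k0|], both finite. *)
  apply: (@le_lt_trans _ _
      (\int[mu]_s (`|(h0 s)%:E| * (\int[mu]_r `|(k0 r)%:E|)))%E).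
    apply: ge0_le_integral => //.
    - by move=> s _; exact: integral_ge0.
    - apply: (measurable_fun_fubini_tonelli_F (m2 := mu)
        (abse \o (EFin \o Phi))) => //=.
      by apply: measurableT_comp => //; exact/measurable_EFinP.
    - apply: emeasurable_funM => //.
      by apply: measurableT_comp => //; exact/measurable_EFinP.
    - move=> s _; rewrite -ge0_integralZl//; last first.
        by apply: measurableT_comp => //; exact/measurable_EFinP.
      apply: ge0_le_integral => //.
      + apply: measurableT_comp => //; apply/measurable_EFinP.
        exact: (measurableT_comp mPhi (pair1_measurable s)).
      + apply: emeasurable_funM => //.
        by apply: measurableT_comp => //; exact/measurable_EFinP.
      + move=> r _; rewrite /= /Phi/=; case: ifPn => _.
          by rewrite normrM EFinM.
        by rewrite normr0 -EFinM lee_fin mulr_ge0.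
  move: ih0 ik0 => /integrableP[_ ih0] /integrableP[_ ik0].
  rewrite ge0_integralZr//.
  - rewrite lte_mul_pinfty//; first exact: integral_ge0.
    by rewrite ge0_fin_numE//; exact: integral_ge0.
  - by apply: measurableT_comp => //; exact/measurable_EFinP.
  - exact: integral_ge0.
rewrite [LHS]Rintegral_mkcond [RHS]Rintegral_mkcond.
have := Fubini iPhi.
(* For [s] in [[0, t]] the constraint [r <= s] already forces [r <= t], so the cut-off in [k0] only
   leaves [0 <= r]. The other order of integration is symmetric. *)
under eq_integral => s _.
  rewrite (_ : (\int[mu]_r (EFin \o Phi) (s, r))%E =
    (((fun s => h s * \int[mu]_(r in `[0, s]) k r) \_ `[0, t]) s)%:E).
    over.
  rewrite patchE; case: ifPn => [|st]; last first.
    rewrite integral0_eq// => r _ /=.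
    by rewrite /Phi/= /h0 patchE (negbTE st) mul0r; case: ifPn.
  rewrite inE/= in_itv/= => /andP[s0 st].
  have iks : mu.-integrable `[0, s] (EFin \o k).
    by apply: integrableS ik => //; apply: subset_itvl.
  transitivity (\int[mu]_(r in `[0%R, s]) (h s * k r)%:E)%E.
    rewrite [RHS]integral_mkcond; apply: eq_integral => r _.
    rewrite restrict_EFin /= /Phi/= /h0 /k0 !patchE !mem_setE !in_itv/= s0 st/=.
    case: (leP r s) => rs; last by rewrite andbF.
    by rewrite (le_trans rs st) andbT; case: ifP; rewrite ?mulr0.
  rewrite /Rintegral EFinM fineK; last exact: integrable_fin_num.
  rewrite -integralZl//.
under [X in _ = X -> _]eq_integral => r _.
  rewrite (_ : (\int[mu]_s (EFin \o Phi) (s, r))%E =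
    (((fun r => k r * \int[mu]_(s in `[r, t]) h s) \_ `[0, t]) r)%:E).
    over.
  rewrite patchE; case: ifPn => [|rt]; last first.
    rewrite integral0_eq// => s _ /=.
    by rewrite /Phi/= /k0 patchE (negbTE rt) mulr0; case: ifPn.
  rewrite inE/= in_itv/= => /andP[r0 rt].
  have ihr : mu.-integrable `[r, t] (EFin \o h).
    by apply: integrableS ih => //; apply: subset_itvr.
  transitivity (\int[mu]_(s in `[r, t]) (k r * h s)%:E)%E.
    rewrite [RHS]integral_mkcond; apply: eq_integral => s _.
    rewrite restrict_EFin /= /Phi/= /h0 /k0 !patchE !mem_setE !in_itv/= r0 rt/=.
    case: (leP r s) => rs //=.
    by rewrite (le_trans r0 rs)/= mulrC; case: ifP; rewrite ?mulr0.
  rewrite /Rintegral EFinM fineK; last exact: integrable_fin_num.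
  rewrite -integralZl//.
by rewrite /Rintegral => ->.
Qed.

(** A continuous function on a compact interval is bounded and measurable. *)
Lemma integrable_continuousM (H k : R -> R) (t : R) :
  {within `[0, t], continuous H} ->
  mu.-integrable `[0, t] (EFin \o k) ->
  mu.-integrable `[0, t] (EFin \o (fun s => H s * k s)).
Proof.
move=> cH ik.
have cpt : compact `[0, t]%classic by exact: segment_compact.
apply: (integrableMr _ _ _ ik) => //.
  exact: subspace_continuous_measurable_fun.
have /compact_bounded[M [_ HM]] := continuous_compact cH cpt.
by exists M; split; rewrite ?num_real // => ? ? ? ?; exact: HM.
Qed.

(* The hypotheses make H absolutely continuous with density h; the identity is
   then Fubini on the triangle r <= s <= t. *)
Lemma Rintegration_by_parts_primitive (H h k : R -> R) (t : R) :
  {within `[0, t], continuous H} ->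
  mu.-integrable `[0, t] (EFin \o h) ->
  mu.-integrable `[0, t] (EFin \o k) ->
  (forall s, 0 <= s <= t -> \int[mu]_(r in `[0, s]) h r = H s - H 0) ->
  \int[mu]_(s in `[0, t]) (H s * k s) =
  H t * \int[mu]_(s in `[0, t]) k s -
  \int[mu]_(s in `[0, t]) (h s * \int[mu]_(r in `[0, s]) k r).
Proof.
move=> cH ih ik hH; rewrite Rintegral_swap_triangle//.
have iHk := integrable_continuousM _ _ _ cH ik.
rewrite -RintegralZl// -[RHS]opprK opprB.
(* The integral of [h] over [[r, t]] is [H t - H r]; after expansion the part in [H t] cancels the
   boundary term. *)
under [X in - (X - _)]eq_Rintegral => r.
  rewrite inE/= in_itv/= => r0t; have /andP[r0 rt] := r0t.
  have t0 := le_trans r0 rt.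
  rewrite (_ : \int[mu]_(s in `[r, t]) h s = H t - H r); last first.
    rewrite -Rintegral_itv_obnd_cbnd; last first.
      by apply: integrableS ih => //; apply: subset_itv; rewrite bnd_simp.
    by rewrite -(Rintegral_itvB ih)// !hH ?t0 ?lexx//; ring.
  rewrite mulrC mulrBl. over.
rewrite RintegralB//; last by apply: integrable_continuousM => //; exact: cst_continuous.
by ring.
Qed.

(** Differentiability is asked for [s > 0] only, with right continuity at 0: [Afun p] is constant on
    the negative axis, so it has no two-sided derivative at 0 when [p 0 > 0]. *)
Lemma Rintegral_derive_halfline (H h : R -> R) (t : R) :
  0 <= t ->
  {within `[0, t], continuous h} ->
  (forall s : R, 0 < s -> is_derive s 1 H (h s)) ->
  H s @[s --> 0^'+] --> H 0 ->
  \int[mu]_(s in `[0, t]) h s = H t - H 0.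
Proof.
rewrite le_eqVlt => /predU1P[<- _ _ _|t0 ch dH H0].
  by rewrite set_itv1 Rintegral_set1 subrr.
have cH (s : R) : 0 < s -> {for s, continuous H}.
  by move=> /dH[dHs _]; exact/differentiable_continuous/derivable1_diffP.
rewrite /Rintegral (continuous_FTC2 (F := H) t0 ch)//.
- split => //; last exact/cvg_at_left_filter/cH.
  by move=> s; rewrite in_itv/= => /andP[/dH[]].
- by move=> s; rewrite in_itv/= => /andP[/dH[_ <-] _]; rewrite derive1E.
Qed.

(** Monotone convergence along integer endpoints gives one [n] with a large integral; as [p] is
    nonnegative, the bound persists for every real [t >= n]. *)
Lemma primitive_cvg_pinfty (p : R -> R) (K : R) :
  (forall t : R, 0 <= t -> 0 <= p t) ->
  (forall t : R, 0 <= t -> mu.-integrable `[0, t] (EFin \o p)) ->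
  (\int[mu]_(t in `[0%R, +oo[) (p t)%:E = +oo)%E ->
  \forall t \near +oo, K <= \int[mu]_(s in `[0, t]) p s.
Proof.
move=> p0 ip ioo.
have : (\int[mu]_(x in `[0%R, (0 + n%:R)%R]) (p x)%:E)%E @[n --> \oo] --> +oo%E.
  rewrite -ioo itv_bndy_bigcup_BRight.
  apply: ge0_nondecreasing_set_cvg_integral => //.
  - move=> m n mn; apply/subsetPset; apply: subset_itvl.
    by rewrite bnd_simp lerD2l ler_nat.
  - by move=> n; have /integrableP[] := ip (0 + n%:R) (addr_ge0 (lexx 0) (ler0n _ n)).
  - by move=> n s/=; rewrite in_itv/= lee_fin => /andP[/p0].
move=> /cvgeyPge /(_ K)[n _ /(_ n (leqnn n))/=]; rewrite add0r => Kn.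
near=> t.
have nt : n%:R <= t by near: t; exact: nbhs_pinfty_ge.
have t0 : 0 <= t by exact: le_trans nt.
rewrite -lee_fin fineK; last exact: (integrable_fin_num _ (ip _ t0)).
apply: (le_trans Kn); apply: ge0_subset_integral => //.
- by have /integrableP[] := ip _ t0.
- by move=> s/=; rewrite in_itv/= lee_fin => /andP[/p0].
- exact: subset_itvl.
Unshelve. all: by end_near. Qed.

(** * Calculus of [o(h)] at infinity *)

Lemma littleo_pinftyD (g1 g2 h : R -> R) :
  littleo_pinfty g1 h -> littleo_pinfty g2 h ->
  littleo_pinfty (fun t => g1 t + g2 t) h.
Proof.
move=> o1 o2 e e0; have e20 : 0 < e / 2 by rewrite divr_gt0.
move: (o1 _ e20) (o2 _ e20); apply: filterS2 => t h1 h2.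
rewrite (le_trans (ler_normD _ _))// (splitr e) mulrDl lerD//.
Qed.

Lemma littleo_pinftyZ (a : R) (g h : R -> R) :
  littleo_pinfty g h -> littleo_pinfty (fun t => a * g t) h.
Proof.
move=> o e e0; have a0 : 0 < `|a| + 1 by rewrite ltr_wpDl.
apply: filterS (o _ (divr_gt0 e0 a0)) => t gt.
rewrite normrM (le_trans (ler_wpM2l (normr_ge0 a) gt))// mulrA ler_wpM2r//.
by rewrite mulrA ler_pdivrMr// mulrC ler_pM2l// lerDl.
Qed.

Lemma eq_littleo_pinfty (g1 g2 h : R -> R) :
  (forall t, 0 < t -> g1 t = g2 t) ->
  littleo_pinfty g1 h -> littleo_pinfty g2 h.
Proof.
move=> g12 o e e0; near=> t; rewrite -g12; first by near: t; exact: o.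
by near: t; exact: nbhs_pinfty_gt.
Unshelve. all: by end_near. Qed.

(* As a linear system in (X, Y), the two relations have determinant
   w^4 + w^2, which is nonzero. *)
Lemma littleo_pinfty_resonance (w : R) (X Y U V h : R -> R) : 0 < w ->
  littleo_pinfty (fun t => U t + - w * Y t - w ^+ 2 * X t) h ->
  littleo_pinfty (fun t => V t + w * X t - w ^+ 2 * Y t) h ->
  (littleo_pinfty X h /\ littleo_pinfty Y h) <->
  (littleo_pinfty U h /\ littleo_pinfty V h).
Proof.
move=> w_gt0 oU oV.
have det0 : w ^+ 2 + 1 != 0 by rewrite gt_eqF// ltr_wpDl// sqr_ge0.
have w0 : w != 0 by rewrite gt_eqF.
have lin (g1 g2 g3 g4 g : R -> R) (a1 a2 a3 a4 : R) :
    littleo_pinfty g1 h -> littleo_pinfty g2 h ->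
    littleo_pinfty g3 h -> littleo_pinfty g4 h ->
    (forall t, a1 * g1 t + a2 * g2 t + (a3 * g3 t + a4 * g4 t) = g t) ->
    littleo_pinfty g h.
  move=> o1 o2 o3 o4 gE; apply: (eq_littleo_pinfty _ _ _ (fun t _ => gE t)).
  by apply: littleo_pinftyD; apply: littleo_pinftyD; exact: littleo_pinftyZ.
split=> [] [s1 s2]; split.
- by apply: (lin _ _ _ _ _ 1 0 (w ^+ 2) w oU oV s1 s2) => t; ring.
- by apply: (lin _ _ _ _ _ 0 1 (- w) (w ^+ 2) oU oV s1 s2) => t; ring.
(* Coefficients of the inverse matrix: modulo [o(h)], [w U - V] equals [w (w^2 + 1) X], and in the
   next case [U + w V] equals [w (w^2 + 1) Y]. *)
- apply: (lin _ _ _ _ _ (w ^+ 2 + 1)^-1 (- (w * (w ^+ 2 + 1))^-1)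
    (- (w ^+ 2 + 1)^-1) (w * (w ^+ 2 + 1))^-1 s1 s2 oU oV) => t.
  by field; rewrite det0.
- apply: (lin _ _ _ _ _ (w * (w ^+ 2 + 1))^-1 (w ^+ 2 + 1)^-1
    (- (w * (w ^+ 2 + 1))^-1) (- (w ^+ 2 + 1)^-1) s1 s2 oU oV) => t.
  by field; rewrite det0.
Qed.

Lemma littleo_pinfty_mull (g h : R -> R) :
  g t @[t --> +oo] --> 0 -> littleo_pinfty (fun t => g t * h t) h.
Proof.
move=> /cvgrPdist_le g0 e e0; apply: filterS (g0 _ e0) => t.
by rewrite sub0r normrN normrM => ?; rewrite ler_wpM2r.
Qed.

(** A weighted Cesaro argument, used with [a = A']. Past some [S], [|g| <= e / 2], so the tail is at
    most [e / 2] times the mass of [a], hence at most [e / 2 * A t]; the head up to [S] is a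
    constant, absorbed because [A] tends to infinity. *)
Lemma littleo_pinfty_integral (A a g : R -> R) :
  (forall t : R, 0 <= t -> 0 <= a t) ->
  (forall t : R, 0 <= t -> mu.-integrable `[0, t] (EFin \o a)) ->
  (forall t : R, 0 <= t -> mu.-integrable `[0, t] (EFin \o (fun s => g s * a s))) ->
  (forall t : R, 0 <= t -> \int[mu]_(s in `[0, t]) a s = A t - A 0) ->
  0 <= A 0 ->
  (forall K, \forall t \near +oo, K <= A t) ->
  g t @[t --> +oo] --> 0 ->
  littleo_pinfty (fun t => \int[mu]_(s in `[0, t]) (g s * a s)) A.
Proof.
move=> a0 ia iga aA A0 Aoo /cvgrPdist_le g0 e e0.
have e20 : 0 < e / 2 by rewrite divr_gt0.
have [T [Treal gT]] := g0 _ e20.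
(* The bound on [g] holds strictly beyond [T], and [S] must also be nonnegative to split
   [[0, t]]. *)
pose S := `|T| + 1.
have S0 : 0 <= S by rewrite addr_ge0.
have gS (s : R) : S <= s -> `|g s| <= e / 2.
  move=> Ss; have := gT s; rewrite sub0r normrN; apply.
  by rewrite (le_lt_trans (ler_norm _))// (lt_le_trans _ Ss)// ltrDl.
pose C := `|\int[mu]_(s in `[0, S]) (g s * a s)|.
near=> t.
have St : S <= t by near: t; apply: nbhs_pinfty_ge; exact: num_real.
have t0 := le_trans S0 St.
(* This makes the head at most [e / 2 * A t], and also shows [A t >= 0]. *)
have CA : C / (e / 2) <= A t by near: t; exact: Aoo.
have At0 : 0 <= A t by apply: le_trans CA; rewrite divr_ge0 ?normr_ge0 ?(ltW e20).
have sub : `]S, t] `<=` `[0, t].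
  by apply: subset_itv; rewrite bnd_simp.
have iat : mu.-integrable `]S, t] (EFin \o a).
  by apply: integrableS (ia _ t0).
have igat : mu.-integrable `]S, t] (EFin \o (fun s => g s * a s)).
  by apply: integrableS (iga _ t0).
have tail : `|\int[mu]_(s in `]S, t]) (g s * a s)| <= e / 2 * A t.
  apply: (le_trans (le_normr_Rintegral _ igat)) => //.
  apply: (@le_trans _ _ (\int[mu]_(s in `]S, t]) (e / 2 * a s))).
    apply: le_Rintegral => //.
    - exact: (integrable_norm igat).
    - exact: (integrableZl _ _ iat).
    - move=> s /=; rewrite in_itv/= => /andP[Ss _].
      have as0 : 0 <= a s by rewrite a0// (le_trans S0)// ltW.
      by rewrite normrM (ger0_norm as0) ler_wpM2r// gS// ltW.
  rewrite RintegralZl// ler_wpM2l ?(ltW e20)//.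
  rewrite -(Rintegral_itvB (ia _ t0))// !aA//.
  (* The mass on []S, t]] is [A t - A S], and [A S >= A 0 >= 0]. *)
  suff : 0 <= A S - A 0 by lra.
  rewrite -aA//; apply: Rintegral_ge0 => s /=.
  by rewrite in_itv/= => /andP[/a0].
have := Rintegral_itvB (iga _ t0) (x := S).
rewrite !bnd_simp => /(_ S0 St)/eqP; rewrite subr_eq => /eqP ->.
rewrite (le_trans (ler_normD _ _))// (ger0_norm At0) (splitr e) mulrDl lerD//.
by rewrite mulrC -ler_pdivrMr.
Unshelve. all: by end_near. Qed.

End Preliminaries.

Section DampedForcing.
Context {R : realType}.
Notation mu := (@lebesgue_measure R).

Lemma within_continuousM (S : set R) (g h : R -> R) :
  {within S, continuous g} -> {within S, continuous h} ->
  {within S, continuous (fun s => g s * h s)}.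
Proof. by move=> cg ch z; apply: continuousM; [exact: cg|exact: ch]. Qed.

(** At 0, [p h] is [p 0] plus [h] times the difference quotient, which converges. *)
Lemma C1_on_nonneg_continuous (p dp : R -> R) :
  C1_on_nonneg p dp -> {within `[0, +oo[, continuous p}.
Proof.
move=> [dpt [dp0 _]]; apply/(continuous_within_itvcyP 0 p); split.
  move=> t; rewrite in_itv/= andbT => /dpt[pt _].
  exact/differentiable_continuous/derivable1_diffP.
have h0 : h @[h --> (0 : R)^'+] --> (0 : R).
  by apply: cvg_at_right_filter; exact: cvg_id.
have := cvgD (cvgM h0 dp0) (cvg_cst (p 0)).
rewrite mul0r add0r => /(_ _ _ _) lim0; apply: (cvg_trans _ lim0); apply: near_eq_cvg; near=> h.
have h_gt0 : 0 < h by near: h; exact: nbhs_right_gt.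
rewrite (_ : (_ + _) h = h * (h^-1 * (p h - p 0)) + p 0)//.
by rewrite mulrA divff ?gt_eqF// mul1r subrK.
Unshelve. all: by end_near. Qed.

(** * The amplitude [A]: regularity, derivative, divergence *)

Section Amplitude.
Context (p : R -> R) (cp : {within `[0, +oo[, continuous p}).

Lemma within_continuous_p (t : R) : {within `[0, t], continuous p}.
Proof. by apply: continuous_subspaceW cp; exact: subset_itvl. Qed.

Lemma integrable_p (t : R) : mu.-integrable `[0, t] (EFin \o p).
Proof.
apply: continuous_compact_integrable; first exact: segment_compact.
exact: within_continuous_p.
Qed.

Lemma Afun_gt0 (t : R) : 0 < Afun p t.
Proof. exact: expR_gt0. Qed.

Lemma Afun_continuous (t : R) : {within `[0, t], continuous (Afun p)}.
Proof.
have [t0|t0] := leP 0 t; last first.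
  by rewrite set_itv_ge ?bnd_simp -?ltNge//; exact: continuous_subspace0.
move=> z; apply: continuous_comp; last exact: continuous_expR.
apply: continuousM; first exact: cst_continuous.
have cI := parameterized_integral_continuous t0 (integrable_p t); exact: cI.
Qed.

Lemma Afun_derive (t : R) :
  0 < t -> is_derive t 1 (Afun p) (2^-1 * p t * Afun p t).
Proof.
move=> t0.
have cpt : {for t, continuous p}.
  move/continuous_within_itvcyP: cp => [+ _]; apply.
  by rewrite in_itv/= andbT.
(* The endpoint [t + 1] makes [t] an interior point for the fundamental theorem. *)
have tt1 : t < t + 1 by rewrite ltrDl.
have [dP P'] := continuous_FTC1_closed tt1 (integrable_p _) t0 cpt.
set P := fun x => _ in dP P'.
have isP : is_derive t 1 P (p t) 
  by apply: (DeriveDef dP); rewrite -derive1E; exact: P'.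
have -> : Afun p = expR \o (2^-1 *: P) by [].
have isZ := is_deriveZ 2^-1 isP.
apply: is_derive_eq.
by rewrite mulrC; congr (_ * _).
Qed.

Lemma Rintegral_Afun (t : R) : 0 <= t ->
  \int[mu]_(s in `[0, t]) (2^-1 * p s * Afun p s) = Afun p t - Afun p 0.
Proof.
move=> t0; apply: Rintegral_derive_halfline => //.
- apply: within_continuousM; last exact: Afun_continuous.
  apply: within_continuousM; last exact: within_continuous_p.
  by move=> z; exact: cst_continuous.
- exact: Afun_derive.
- have /(continuous_within_itvP _ (@ltr01 R))[_ A0 _] := Afun_continuous 1.
  exact: A0.
Qed.

Lemma Afun_cvg_pinfty (K : R) :
  (forall t, 0 <= t -> 0 < p t) ->
  (\int[mu]_(t in `[0%R, +oo[) (p t)%:E = +oo)%E ->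
  \forall t \near +oo, K <= Afun p t.
Proof.
move=> p0 poo; near=> t.
(* By [1 + x <= expR x], it suffices that the primitive of [p] eventually exceeds [2 (K - 1)]. *)
rewrite (le_trans _ (expR_ge1Dx _))// -lerBlDl -ler_pdivrMl//.
near: t; apply: primitive_cvg_pinfty => // t t0; first exact/ltW/p0.
exact: integrable_p.
Unshelve. all: by end_near. Qed.

(** * The solution [y1] and integrals against the forcing [f] *)

Section Forcing.
Context (w : R) (f : R -> R) (hf : L1loc_nonneg f).

Let k (s : R) := expR (w ^+ 2 * s) * f s.

Lemma continuous_expRZ (a : R) (S : set R) :
  {within S, continuous (fun s => expR (a * s))}.
Proof.
apply: continuous_subspaceT => z.
apply: continuous_comp; last exact: continuous_expR.
exact: mulrl_continuous.
Qed.

Let ik (t : R) : 0 <= t -> mu.-integrable `[0, t] (EFin \o k).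
Proof.
by move=> t0; apply: integrable_continuousM; [exact: continuous_expRZ|exact: hf].
Qed.

(** Factoring out the exponential in [t] removes [t] from the integrand, so [y1] becomes a smooth
    factor times the primitive of [k]. *)
Lemma y1funE (t : R) :
  y1fun w f t = expR (- (w ^+ 2) * t) *
    \int[mu]_(s in `[0, t]) (expR (w ^+ 2 * s) * f s).
Proof.
have [t0|t0] := leP 0 t; last first.
  by rewrite /y1fun set_itv_ge ?bnd_simp -?ltNge// !Rintegral_set0 mulr0.
rewrite -RintegralZl//; last exact: ik.
apply: eq_Rintegral => s _; rewrite mulrA -expRD; congr (expR _ * _).
by ring.
Qed.

Lemma y1fun_continuous (t : R) : {within `[0, t], continuous (y1fun w f)}.
Proof.
have [t0|t0] := leP 0 t; last first.
  by rewrite set_itv_ge ?bnd_simp -?ltNge//; exact: continuous_subspace0.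
rewrite (_ : y1fun w f = fun s => expR (- (w ^+ 2) * s) *
    parameterized_integral mu 0 s k); last by apply/funext => s; exact: y1funE.
apply: within_continuousM; first exact: continuous_expRZ.
have cK := parameterized_integral_continuous t0 (ik t t0).
exact: cK.
Qed.

Lemma integrable_Afun_y1 (c : R -> R) (t : R) : continuous c ->
  mu.-integrable `[0, t] (EFin \o (fun s => c s * Afun p s * y1fun w f s)).
Proof.
move=> cc; apply: continuous_compact_integrable; first exact: segment_compact.
apply: within_continuousM; last exact: y1fun_continuous.
apply: within_continuousM; last exact: Afun_continuous.
exact: continuous_subspaceT.
Qed.

Lemma integrable_y1_dAfun (c : R -> R) (t : R) : continuous c ->
  mu.-integrable `[0, t]
    (EFin \o (fun s => c s * y1fun w f s * (2^-1 * p s * Afun p s))).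
Proof.
move=> cc; apply: continuous_compact_integrable; first exact: segment_compact.
apply: within_continuousM.
  by apply: within_continuousM; [exact: continuous_subspaceT|exact: y1fun_continuous].
apply: within_continuousM; last exact: Afun_continuous.
apply: within_continuousM; last exact: within_continuous_p.
by move=> z; exact: cst_continuous.
Qed.

(* Integration by parts against y1' = - w^2 y1 + f, done for the absolutely
   continuous function exp(w^2 s) y1(s), whose derivative exp(w^2 s) f(s) is
   only integrable. *)
Lemma Rintegral_Afun_f (c d : R -> R) (a t : R) : 0 < t ->
  (forall s : R, is_derive s 1 c (a * d s)) -> continuous d ->
  \int[mu]_(s in `[0, t]) (c s * Afun p s * f s) =
  c t * y1fun w f t * Afun p t
  - a * \int[mu]_(s in `[0, t]) (d s * Afun p s * y1fun w f s)
  - \int[mu]_(s in `[0, t]) (c s * y1fun w f s * (2^-1 * p s * Afun p s))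
  + w ^+ 2 * \int[mu]_(s in `[0, t]) (c s * Afun p s * y1fun w f s).
Proof.
move=> t_gt0 dc cd; have t0 := ltW t_gt0.
have cc : continuous c.
  by move=> s; have [cs _] := dc s; exact/differentiable_continuous/derivable1_diffP.
pose E s := expR (- (w ^+ 2) * s).
(* The factor [E] compensates the exponential in [k], so that [G s * k s = c s * Afun p s * f s];
   [g] is the derivative of [G] by the product rule. *)
pose G s := c s * Afun p s * E s.
pose g s := (a * d s * Afun p s + c s * (2^-1 * p s * Afun p s)
             - w ^+ 2 * (c s * Afun p s)) * E s.
have cE (u : R) : {within `[0, u], continuous E} by exact: continuous_expRZ.
have cG (u : R) : {within `[0, u], continuous G}.
  apply: within_continuousM; last exact: cE.
  apply: within_continuousM; last exact: Afun_continuous.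
  exact: continuous_subspaceT.
have ccst (u b : R) : {within `[0, u], continuous (fun=> b)}.
  by move=> z; exact: cst_continuous.
have cg (u : R) : {within `[0, u], continuous g}.
  apply: within_continuousM; last exact: cE.
  apply: within_continuousB; first apply: within_continuousD.
  - apply: within_continuousM; last exact: Afun_continuous.
    by apply: within_continuousM; [exact: ccst|exact: continuous_subspaceT].
  - apply: within_continuousM; first exact: continuous_subspaceT.
    apply: within_continuousM; last exact: Afun_continuous.
    by apply: within_continuousM; [exact: ccst|exact: within_continuous_p].
  - apply: within_continuousM; first exact: ccst.
    apply: within_continuousM; last exact: Afun_continuous.
    exact: continuous_subspaceT.
have dE (s : R) : is_derive s 1 E (- (w ^+ 2) * E s).
  rewrite (_ : E = expR \o ((- (w ^+ 2)) *: id)); last by [].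
  by apply: is_derive_eq; rewrite mulrC [_ *: 1]mulr1.
have dG (s : R) : 0 < s -> is_derive s 1 G (g s).
  move=> s0; have dcs := dc s; have dAs := Afun_derive _ s0; have dEs := dE s.
  rewrite (_ : G = (c * Afun p) * E); last by [].
  by apply: is_derive_eq; rewrite /g /GRing.scale/= !fctE; ring.
have ig : mu.-integrable `[0, t] (EFin \o g).
  by apply: continuous_compact_integrable; [exact: segment_compact|exact: cg].
have gG s : 0 <= s <= t -> \int[mu]_(r in `[0, s]) g r = G s - G 0.
  move=> /andP[s0 _]; apply: Rintegral_derive_halfline => //.
  have /(continuous_within_itvP _ (@ltr01 R))[_ G0 _] := cG 1.
  exact: G0.
have := Rintegration_by_parts_primitive _ _ _ _ (cG t) ig (ik t t0) gG.
under eq_Rintegral => s _.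
  rewrite (_ : G s * k s = c s * Afun p s * f s); last first.
    rewrite /G /k /E mulrA -(mulrA (c s * Afun p s)) -expRD.
    by rewrite mulNr addNr expR0 mulr1.
  over.
move=> ->.
have -> : G t * \int[mu]_(s in `[0, t]) k s = c t * y1fun w f t * Afun p t.
  by rewrite y1funE /G /E; ring.
(* The factor [E s] in [g s] turns the inner integral of [k] back into [y1]. *)
under eq_Rintegral => s _.
  rewrite (_ : _ * _ = a * (d s * Afun p s * y1fun w f s) +
    c s * y1fun w f s * (2^-1 * p s * Afun p s) -
    w ^+ 2 * (c s * Afun p s * y1fun w f s)); last by rewrite y1funE /g /E; ring.
  over.
have icAy := integrable_Afun_y1 c t cc; have idAy := integrable_Afun_y1 d t cd.
have icyp := integrable_y1_dAfun c t cc.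
rewrite RintegralB//; last first.
- exact: (integrableZl _ _ icAy).
- by have := integrableD _ (integrableZl _ a idAy) icyp; exact.
rewrite RintegralD//; last exact: (integrableZl _ _ idAy).
rewrite !RintegralZl//; ring.
Qed.

(** One statement serves both lines of the system: [(c, d, a)] is [(cos, sin, - w)] or
    [(sin, cos, w)], with arguments scaled by [w]. As [c] is bounded, [c y1] tends to 0, so both the
    boundary term and the integral against [A'] are [o(A)]. *)
Lemma littleo_Afun_f (c d : R -> R) (a : R) :
  (forall s : R, is_derive s 1 c (a * d s)) -> continuous d ->
  (forall s, `|c s| <= 1) ->
  (forall t, 0 <= t -> 0 < p t) ->
  (\int[mu]_(t in `[0%R, +oo[) (p t)%:E = +oo)%E ->
  y1fun w f t @[t --> +oo] --> 0 ->
  littleo_pinfty (fun t =>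
    \int[mu]_(s in `[0, t]) (c s * Afun p s * f s)
    + a * \int[mu]_(s in `[0, t]) (d s * Afun p s * y1fun w f s)
    - w ^+ 2 * \int[mu]_(s in `[0, t]) (c s * Afun p s * y1fun w f s))
    (Afun p).
Proof.
move=> dc cd c1 p0 poo y0.
have cc : continuous c.
  by move=> s; have [cs _] := dc s; exact/differentiable_continuous/derivable1_diffP.
have cy0 : c t * y1fun w f t @[t --> +oo] --> 0.
  apply/cvgrPdist_le => e e0; move/cvgrPdist_le : y0 => /(_ _ e0).
  apply: filterS => t; rewrite !sub0r !normrN normrM; apply: le_trans.
  by rewrite ler_piMl.
have o1 := littleo_pinfty_mull _ (Afun p) cy0.
have o2 : littleo_pinfty (fun t => \int[mu]_(s in `[0, t])
    (c s * y1fun w f s * (2^-1 * p s * Afun p s))) (Afun p).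
  apply: littleo_pinfty_integral => //.
  - by move=> t t0; rewrite !mulr_ge0 ?invr_ge0// ?(ltW (p0 _ t0))// ltW// Afun_gt0.
  - move=> t t0; apply: continuous_compact_integrable; first exact: segment_compact.
    apply: within_continuousM; last exact: Afun_continuous.
    apply: within_continuousM; last exact: within_continuous_p.
    by move=> z; exact: cst_continuous.
  - by move=> t _; exact: integrable_y1_dAfun.
  - by move=> t t0; exact: Rintegral_Afun.
  - exact/ltW/Afun_gt0.
  - by move=> K; exact: Afun_cvg_pinfty.
(* Integration by parts is available for [t > 0], which suffices at infinity. *)
apply: eq_littleo_pinfty (littleo_pinftyD _ _ _ o1 (littleo_pinftyZ (-1) _ _ o2)).
by move=> t t0; rewrite /= (Rintegral_Afun_f c d a)//; ring.
Qed.

End Forcing.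
End Amplitude.
End DampedForcing.

Theorem mainTheorem13 (R : realType) (w : R) (p dp f : R -> R)
  (hw : 0 < w)
  (hp1 : C1_on_nonneg p dp)
  (hppos : forall t : R, 0 <= t -> 0 < p t)
  (hdpneg : forall t : R, 0 <= t -> dp t < 0)
  (hpint : (\int[@lebesgue_measure R]_(t in `[0%R, +oo[) (p t)%:E = +oo)%E)
  (hp2 : (\int[@lebesgue_measure R]_(t in `[0%R, +oo[) ((p t) ^+ 2)%:E < +oo)%E)
  (hf : L1loc_nonneg f)
  (hy1 : y1fun w f t @[t --> +oo] --> 0) :
  (littleo_pinfty
     (fun t => \int[@lebesgue_measure R]_(s in `[0, t]) (cos (w * s) * Afun p s * y1fun w f s))
     (Afun p) /\
   littleo_pinfty
     (fun t => \int[@lebesgue_measure R]_(s in `[0, t]) (sin (w * s) * Afun p s * y1fun w f s))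
     (Afun p))
  <->
  (littleo_pinfty
     (fun t => \int[@lebesgue_measure R]_(s in `[0, t]) (cos (w * s) * Afun p s * f s))
     (Afun p) /\
   littleo_pinfty
     (fun t => \int[@lebesgue_measure R]_(s in `[0, t]) (sin (w * s) * Afun p s * f s))
     (Afun p)).
Proof.
have cp := C1_on_nonneg_continuous p dp hp1.
(* Chain rule for the scaling by [w], in the shape [a * d s]; the bare derivatives of [cos] and
   [sin] enter with [b = -1] and [b = 1]. *)
have cwD (c dc : R -> R) (b : R) :
    (forall x : R, is_derive x 1 c (b * dc x)) ->
    forall s : R, is_derive s 1 (fun s => c (w * s)) (b * w * dc (w * s)).
  move=> hc s; rewrite (_ : (fun s => _) = c \o (w *: id)); last by [].
  have hcs := hc ((w *: id) s); have h1 := is_deriveZ w (is_derive_id s 1).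
  by apply: is_derive_eq; rewrite [w *: 1]mulr1 mulrAC.
have dcos (s : R) : is_derive s 1 (fun s => cos (w * s)) (- w * sin (w * s)).
  have dc (x : R) : is_derive x 1 cos (-1 * sin x) by rewrite mulN1r; exact: is_derive_cos.
  by rewrite -(mulN1r w); exact: cwD dc s.
have dsin (s : R) : is_derive s 1 (fun s => sin (w * s)) (w * cos (w * s)).
  have dc (x : R) : is_derive x 1 sin (1 * cos x) by rewrite mul1r; exact: is_derive_sin.
  by rewrite -[w in w * cos _]mul1r; exact: cwD dc s.
have cw (c : R -> R) : continuous c -> continuous (fun s => c (w * s)).
  move=> cc s; apply: continuous_comp; last exact: cc.
  exact: mulrl_continuous.
apply: (littleo_pinfty_resonance w _ _ _ _ _ hw).
- exact: (littleo_Afun_f p cp w f hf _ _ _ dcos (cw _ (@continuous_sin R))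
    (fun s => cos_max _) hppos hpint hy1).
- exact: (littleo_Afun_f p cp w f hf _ _ _ dsin (cw _ (@continuous_cos R))
    (fun s => sin_max _) hppos hpint hy1).
Qed.
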